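(* Let $X$ be a finite set with $|X|\ge 2$. Let $K\subseteq\mathcal{L}\text{-}\mathrm{Geo}(\mathrm{FIM}_X)$ (resp. $K\subseteq\mathcal{R}\text{-}\mathrm{Geo}(\mathrm{FIM}_X)$) be a language containing at least one representative of each $\mathcal{L}$-class (resp. each $\mathcal{R}$-class) of $\mathrm{FIM}_X$, i.e. for every such class $C$ there is $w\in K$ with $w\pi\in C$. Then $K$ is not context-free. In particular, for any fixed total order on $\tilde X$, the languages $\mathcal{L}\text{-}\mathrm{Geo}(\mathrm{FIM}_X)$ and $\mathcal{L}\text{-}\mathrm{SL}(\mathrm{FIM}_X)$ (resp. $\mathcal{R}\text{-}\mathrm{Geo}(\mathrm{FIM}_X)$ and $\mathcal{R}\text{-}\mathrm{SL}(\mathrm{FIM}_X)$) are not context-free.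
   Context: $\mathrm{FIM}_X$ is the free inverse monoid on $X$; $\tilde X=X\cup X^{-1}$ with $X^{-1}=\{x^{-1}:x\in X\}$ a disjoint copy of $X$; $\pi:\tilde X^*\to \mathrm{FIM}_X$ is the canonical surjective homomorphism; $\ell(w)$ is the length of the word $w$. For $\mathcal{K}\in\{\mathcal{L},\mathcal{R}\}$ the corresponding Green's relation on $\mathrm{FIM}_X$, $$\mathcal{K}\text{-}\mathrm{Geo}(\mathrm{FIM}_X)=\bigl\{w\in\tilde X^*: \ell(w)=\min\{\ell(u): u\in\tilde X^*,\ (u\pi)\,\mathcal{K}\,(w\pi)\}\bigr\}.$$ A total order on $\tilde X$ induces the ShortLex order on $\tilde X^*$ (shorter words first, words of equal length compared lexicographically), and $\mathcal{K}\text{-}\mathrm{SL}(\mathrm{FIM}_X)$ is the set of $w\in\tilde X^*$ that are ShortLex-minimal in $\{u\in\tilde X^*: (u\pi)\,\mathcal{K}\,(w\pi)\}$. *)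

(* Defs.v *)
From HB Require Import structures.
From mathcomp Require Import all_boot.
From mathcomp Require Import boolp classical_sets.
From Stdlib Require Import Relation_Operators.

Set Implicit Arguments.
Unset Strict Implicit.
Unset Printing Implicit Defensive.

Local Open Scope classical_set_scope.
Local Open Scope quotient_scope.

(* The alphabet [X \cup X^-1]: [inl x] is the letter x, [inr x] is x^-1. *)
Definition letter (X : finType) : finType := (X + X)%type.

Definition word (X : finType) : choiceType := seq (letter X).

Definition letter_inv (X : finType) (a : letter X) : letter X :=
  match a with inl x => inr x | inr x => inl x end.

Definition word_inv (X : finType) (w : word X) : word X :=
  rev (map (@letter_inv X) w).

(* The Vagner congruence: the congruence on words generated by the pairs
   (u u^-1 u, u) and (u u^-1 v v^-1, v v^-1 u u^-1). *)
Inductive vagner (X : finType) : word X -> word X -> Prop :=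
| vagner_regular u : vagner (u ++ word_inv u ++ u) u
| vagner_commute u v :
    vagner (u ++ word_inv u ++ v ++ word_inv v)
           (v ++ word_inv v ++ u ++ word_inv u)
| vagner_refl u : vagner u u
| vagner_sym u v : vagner u v -> vagner v u
| vagner_trans u v w : vagner u v -> vagner v w -> vagner u w
| vagner_cat u u' v v' : vagner u u' -> vagner v v' -> vagner (u ++ v) (u' ++ v').

Section FreeInverseMonoid.
Variable X : finType.

Definition vagnerb : rel (word X) := fun u v => `[< vagner u v >].

Lemma vagnerb_refl : reflexive vagnerb.
Proof. by move=> u; apply/asboolP; exact: vagner_refl. Qed.

Lemma vagnerb_sym : symmetric vagnerb.
Proof. by move=> u v; apply/asboolP/asboolP; exact: vagner_sym. Qed.

Lemma vagnerb_trans : transitive vagnerb.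
Proof.
by move=> v u w /asboolP uv /asboolP vw; apply/asboolP; exact: vagner_trans vw.
Qed.

Canonical vagner_equiv :=
  EquivRel vagnerb vagnerb_refl vagnerb_sym vagnerb_trans.

Definition FIM := {eq_quot vagner_equiv}.
HB.instance Definition _ := Choice.on FIM.
HB.instance Definition _ := EqQuotient.on FIM.

Definition fim_pi (w : word X) : FIM := \pi_FIM w.

Lemma fim_piP u v : fim_pi u = fim_pi v <-> vagner u v.
Proof.
rewrite /fim_pi; split=> [/eqquotP /asboolP // | uv].
by apply/eqquotP; apply/asboolP.
Qed.

Lemma fim_pi_repr (a : FIM) : fim_pi (repr a) = a.
Proof. exact: reprK. Qed.

Definition fim_one : FIM := fim_pi [::].
Definition fim_mul (a b : FIM) : FIM := fim_pi (repr a ++ repr b).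

Lemma fim_mulE u v : fim_mul (fim_pi u) (fim_pi v) = fim_pi (u ++ v).
Proof.
by apply/fim_piP; apply: vagner_cat; apply/fim_piP; exact: fim_pi_repr.
Qed.

Lemma fim_mulA : associative fim_mul.
Proof.
move=> a b c; rewrite -(fim_pi_repr a) -(fim_pi_repr b) -(fim_pi_repr c).
by rewrite !fim_mulE catA.
Qed.

Lemma fim_mul1 : left_id fim_one fim_mul.
Proof. by move=> a; rewrite -(fim_pi_repr a) fim_mulE. Qed.

Lemma fim_mulr1 : right_id fim_one fim_mul.
Proof. by move=> a; rewrite -(fim_pi_repr a) fim_mulE cats0. Qed.

HB.instance Definition _ := isMonoid.Build FIM fim_mulA fim_mul1 fim_mulr1.

Lemma fim_pi1 : fim_pi [::] = 1%g.
Proof. by []. Qed.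

Lemma fim_piM u v : fim_pi (u ++ v) = (fim_pi u * fim_pi v)%g.
Proof. by rewrite -fim_mulE. Qed.

End FreeInverseMonoid.

(* Green's relations: equality of principal left (resp. right) ideals. *)
Definition greenL (M : monoidType) (a b : M) : Prop :=
  range (fun s : M => (s * a)%g) = range (fun s : M => (s * b)%g).

Definition greenR (M : monoidType) (a b : M) : Prop :=
  range (fun s : M => (a * s)%g) = range (fun s : M => (b * s)%g).

Definition green_class (M : monoidType) (G : M -> M -> Prop) (C : set M) : Prop :=
  exists a, C = [set b | G b a].

Definition is_min (S : set nat) (m : nat) : Prop :=
  S m /\ forall n, S n -> m <= n.

Definition Geo (X : finType) (G : FIM X -> FIM X -> Prop) : set (word X) :=
  [set w | is_min [set size u | u in [set u | G (fim_pi u) (fim_pi w)]] (size w)].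

(* [total] includes reflexivity. *)
Definition total_order (T : Type) (le : rel T) : Prop :=
  [/\ antisymmetric le, transitive le & total le].

Fixpoint lex (T : eqType) (le : rel T) (u v : seq T) : bool :=
  match u, v with
  | [::], _ => true
  | _ :: _, [::] => false
  | a :: u', b :: v' => if a == b then lex le u' v' else le a b
  end.

Definition shortlex (T : eqType) (le : rel T) (u v : seq T) : bool :=
  (size u < size v) || (size u == size v) && lex le u v.

Definition SL (X : finType) (le : rel (letter X)) (G : FIM X -> FIM X -> Prop) :
    set (word X) :=
  [set w | forall u, G (fim_pi u) (fim_pi w) -> shortlex le w u].

(* In a sentential form, [inl A] is a nonterminal and [inr a] a terminal. *)
Record cfg (T : finType) := CFG {
  nonterminal : finType;
  start : nonterminal;
  productions : seq (nonterminal * seq (nonterminal + T)) }.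

Definition cfg_step (T : finType) (g : cfg T) (x y : seq (nonterminal g + T)) : Prop :=
  exists u v A r, [/\ (A, r) \in productions g,
    x = u ++ inl A :: v & y = u ++ r ++ v].

Definition cfg_language (T : finType) (g : cfg T) : set (seq T) :=
  [set w | clos_refl_trans _ (@cfg_step T g) [:: inl (start g)] (map inr w)].

Definition context_free (T : finType) (L : set (seq T)) : Prop :=
  exists g : cfg T, cfg_language g = L.

(* Main.v *)
Require Import Defs.
From mathcomp Require Import all_boot boolp classical_sets.
From mathcomp Require Import zify.
From Stdlib Require Import Relation_Operators Operators_Properties.

(** A word is read as a walk from the root of the Cayley tree of the free group.
    Two words are R-related exactly when their walks cover the same subtree (the
    Munn tree), so an R-geodesic is a shortest walk from the root that covers a
    given finite subtree.

    Let [b] and [a] be two distinct generators and [B] the inverse of [b]. The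
    words used are the tours [B b b^i B^j a^k]: visit the hair [B] at the root,
    go up a branch of [b]s, come back down, and leave along [a^k].

    For [i = k = n + 1] and [j = n] the tree has the leaves [B], [b^(n+1)] and
    [b a^(n+1)]. Any walk through these leaves in another order is longer than
    the tour, and in this order every leg has to be the reduced path; hence the
    tour is the only geodesic of its class ([tour_unique]), and it lies in every
    set [K] of geodesics that meets all the classes.

    On the other hand a geodesic tour satisfies [j <= i] and [j <= k]
    ([Geo_tour]): for [j > i] the walk runs through the hair a third time, and
    for [j > k] it would be shorter to finish at the top of the [b]-branch.

    If [K] were context-free, the tours with large [n] could be pumped, and
    pumping can be made compatible with any finite colouring of prefixes
    ([coloured_pumping]). Colour a prefix by the state of the automaton of
    [B b b* B* a*] and by the parity of its length. Then pumped words are again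
    tours, each pumped factor is an even power of one letter, and the exponents
    [(i, j, k)] move along a vector [(p, q, r)] of even numbers that has a zero
    entry but is not zero. The two inequalities, used for 0 and for 3 copies of
    the pumped factors, give [q <= p <= q + 1] and [q <= r <= q + 1], so that
    [p = q = r] by parity: a contradiction.

    Inversion of words is an anti-automorphism that exchanges L and R, preserves
    lengths, and preserves context-freeness by mirroring the grammar; this gives
    the case of L. The geodesics, and the ShortLex representatives among them,
    meet every class, so they are instances of [K]. *)

Set Implicit Arguments.
Unset Strict Implicit.
Unset Printing Implicit Defensive.

(** * Derivations and a coloured pumping lemma *)

Section Derivations.
Variables (T : finType) (g : cfg T).
Local Notation N := (nonterminal g).
Local Notation form := (seq (N + T)).
Local Notation steps := (clos_refl_trans _ (@cfg_step T g)).

Definition terminals (w : seq T) : form := map inr w.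

Lemma steps_ctx (l r x y : form) :
  steps x y -> steps (l ++ x ++ r) (l ++ y ++ r).
Proof.
elim=> [{}x {}y [u [v [A [s [As -> ->]]]]] | {}x | {}x {}y z _ xy _ yz].
- by apply: rt_step; exists (l ++ u), (v ++ r), A, s; rewrite -!catA.
- exact: rt_refl.
- exact: rt_trans yz.
Qed.

Lemma steps_cat (x x' y y' : form) :
  steps x x' -> steps y y' -> steps (x ++ y) (x' ++ y').
Proof.
move=> xx' yy'; apply: (rt_trans _ _ _ (x' ++ y)).
  exact: (steps_ctx [::] y xx').
by have := steps_ctx x' [::] yy'; rewrite !cats0.
Qed.

Lemma steps_prod (A : N) (r x : form) :
  (A, r) \in productions g -> steps r x -> steps [:: inl A] x.
Proof.
move=> Ar; apply: rt_trans; apply: rt_step.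
by exists [::], [::], A, r; rewrite cats0.
Qed.

(** Big-step form of the rewriting relation: the derivation of a sentential form
    is a forest, which makes induction on parse trees available. *)
Inductive derives : form -> seq T -> Prop :=
| derives_nil : derives [::] [::]
| derives_term a al w : derives al w -> derives (inr a :: al) (a :: w)
| derives_prod A r al w1 w2 : (A, r) \in productions g ->
    derives r w1 -> derives al w2 -> derives (inl A :: al) (w1 ++ w2).

Lemma derives_terminals w : derives (terminals w) w.
Proof. by elim: w => [|a w IH]; constructor. Qed.

Lemma derives_cat al be w1 w2 :
  derives al w1 -> derives be w2 -> derives (al ++ be) (w1 ++ w2).
Proof.
move=> d1 d2; elim: d1 => [//|a al' w _ IH|A r al' v1 v2 Ar dr _ _ IH] /=.
  by constructor.
by rewrite -catA; apply: derives_prod Ar dr IH.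
Qed.

Lemma derives_catE al be w : derives (al ++ be) w ->
  exists w1 w2, [/\ w = w1 ++ w2, derives al w1 & derives be w2].
Proof.
elim: al w => [|c al IH] w /= d; first by exists [::], w; split=> //; constructor.
inversion d as [|a al' w' d' e1 e2|A r al' v1 v2 Ar dr d' e1 e2]; subst.
  have [w1 [w2 [-> d1 d2]]] := IH _ d'.
  by exists (a :: w1), w2; split=> //; constructor.
have [w1 [w2 [-> d1 d2]]] := IH _ d'.
by exists (v1 ++ w1), w2; rewrite catA; split=> //; apply: derives_prod Ar dr d1.
Qed.

Lemma steps_derives al w : steps al (terminals w) -> derives al w.
Proof.
move=> /clos_rt_rt1n_iff; move e: (terminals w) => be st.
elim: st e => [x <-|x y z [u [v [A [r [Ar -> ->]]]]] _ IH /IH].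
  exact: derives_terminals.
move=> /derives_catE [w1 [w2 [-> d1 /derives_catE [w3 [w4 [-> d3 d4]]]]]].
by apply: derives_cat d1 _; apply: derives_prod Ar d3 d4.
Qed.

Lemma derives_steps al w : derives al w -> steps al (terminals w).
Proof.
elim=> [|a al' w' _ IH|A r al' w1 w2 Ar _ IH1 _ IH2]; first exact: rt_refl.
  exact: (@steps_cat [:: inr a] [:: inr a] _ _ (rt_refl _ _ _) IH).
rewrite /terminals map_cat -cat1s.
by apply: steps_cat IH2; apply: steps_prod Ar IH1.
Qed.

Variables (Q : finType) (f : seq T -> Q).
Local Notation key := (N * Q * Q)%type.
Local Notation key_of A u w := ((A, f u, f (u ++ w)) : key).

(** A node of a parse tree gets as key its nonterminal together with the colours
    of the two ends of the factor that it spans; [u] is the part of the word to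
    the left of the forest. A derivation is thin when its keys lie in [F] and no
    key occurs twice on a branch: an expanded key is removed from [F] below. *)
Inductive thin : {set key} -> seq T -> form -> seq T -> Prop :=
| thin_nil (F : {set key}) u : thin F u [::] [::]
| thin_term (F : {set key}) u a al w :
    thin F (rcons u a) al w -> thin F u (inr a :: al) (a :: w)
| thin_prod (F : {set key}) u A r al w1 w2 : key_of A u w1 \in F ->
    (A, r) \in productions g -> thin (F :\ key_of A u w1) u r w1 ->
    thin F (u ++ w1) al w2 -> thin F u (inl A :: al) (w1 ++ w2).

Lemma thin_derives (F : {set key}) u al w : thin F u al w -> derives al w.
Proof.
by elim=> *; [constructor | constructor | apply: derives_prod; eassumption].
Qed.

Lemma thin_steps (F : {set key}) u al w : thin F u al w -> steps al (terminals w).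
Proof. by move/thin_derives/derives_steps. Qed.

Lemma thin_cat (F : {set key}) u al be w1 w2 :
  thin F u al w1 -> thin F (u ++ w1) be w2 -> thin F u (al ++ be) (w1 ++ w2).
Proof.
move=> d; elim: d be w2 => {F u al w1}.
- by move=> F u be w2; rewrite cats0.
- by move=> F u a al w _ IH be w2 d; constructor; apply: IH; rewrite cat_rcons.
- move=> F u A r al w1 w2 kF Ar d1 _ _ IH be w3 d.
  by rewrite -catA; apply: thin_prod Ar d1 _ => //; apply: IH; rewrite -catA.
Qed.

Lemma thin_sub (F F' : {set key}) u al w : F \subset F' -> thin F u al w -> thin F' u al w.
Proof.
move=> sFF' d; elim: d F' sFF' => {F u al w}.
- by move=> *; constructor.
- by move=> F u a al w _ IH F' sFF'; constructor; apply: IH.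
- move=> F u A r al w1 w2 kF Ar _ IH1 _ IH2 F' sFF'.
  apply: thin_prod Ar _ (IH2 _ sFF'); first exact: (fintype.subsetP sFF').
  by apply: IH1; apply: finset.setSD.
Qed.

(** The successor keeps the bound positive for grammars with empty right-hand
   sides. *)
Definition rhs_bound := (\max_(p <- productions g) size p.2).+1.

(** The tree has branching at most [rhs_bound], and each branch has at most one
    node per key of [F]. *)
Lemma thin_size (F : {set key}) u al w : thin F u al w -> size w <= size al * rhs_bound ^ #|F|.
Proof.
elim=> {F u al w} [//|F u a al w _ IH|F u A r al w1 w2 kF Ar _ IH1 _ IH2] /=.
  by rewrite mulSn -add1n leq_add // expn_gt0.
rewrite size_cat mulSn leq_add //; apply: leq_trans IH1 _.
rewrite [X in _ <= _ ^ X](cardsD1 (key_of A u w1)) kF add1n expnS leq_mul2r.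
by apply/orP; right; apply: leqW; exact: (@leq_bigmax_seq _ _ xpredT (fun p => size p.2) _ Ar isT).
Qed.

(** Besides the key, the context of the node is kept, as it is what gets iterated,
    and its own subtree, as it may replace the subtree of an ancestor. *)
Definition occurs (F : {set key}) u (al : form) w (k : key) :=
  exists A v w' y, [/\ w = v ++ w' ++ y, k = key_of A (u ++ v) w',
    steps al (terminals v ++ inl A :: terminals y) &
    thin F (u ++ v) [:: inl A] w'].

Lemma thin_avoid (F : {set key}) u al w k :
  thin F u al w -> thin (F :\ k) u al w \/ occurs F u al w k.
Proof.
elim=> {F u al w}.
- by move=> F u; left; constructor.
- move=> F u a al w _ [d|[A [v [w' [y [-> -> st d]]]]]]; first by left; constructor.
  right; exists A, (a :: v), w', y; rewrite -(cat_rcons a u v).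
  by split=> //; apply: (@steps_cat [:: inr a] [:: inr a] _ _ (rt_refl _ _ _) st).
- move=> F u A r al w1 w2 kF Ar dr IH1 d IH2.
  have [->|nk] := eqVneq k (key_of A u w1).
    right; exists A, [::], w1, w2; rewrite cats0; split=> //.
      exact: (@steps_cat [:: inl A] [:: inl A] _ _ (rt_refl _ _ _) (thin_steps d)).
    rewrite -[X in thin _ _ _ X]cats0; apply: thin_prod dr _ => //.
    by constructor.
  case: IH1 => [d1|[B [v [w' [y [-> -> st dB]]]]]]; last first.
    right; exists B, v, w', (y ++ w2); rewrite -!catA; split=> //; last first.
      by apply: thin_sub dB; apply: finset.subsetDl.
    rewrite /terminals map_cat -cat1s -cat_cons catA.
    by apply: steps_cat (thin_steps d); apply: steps_prod Ar st.
  case: IH2 => [d2|[B [v [w' [y [-> -> st dB]]]]]]; last first.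
    right; exists B, (w1 ++ v), w', y; rewrite -!catA; split=> //; last first.
      by rewrite catA.
    rewrite /terminals map_cat -cat1s -catA.
    by apply: steps_cat st; apply: steps_prod Ar (thin_steps dr).
  left; apply: thin_prod Ar _ d2; first by rewrite !inE eq_sym nk.
  by rewrite finset.setDDl finset.setUC -finset.setDDl.
Qed.

Definition pumpable u (al : form) w :=
  exists A l v x y r, [/\ w = l ++ v ++ x ++ y ++ r, 0 < size (v ++ y),
    [/\ steps al (terminals l ++ inl A :: terminals r),
        steps [:: inl A] (terminals v ++ inl A :: terminals y) &
        steps [:: inl A] (terminals x)],
    f (u ++ l) = f (u ++ l ++ v) &
    f (u ++ l ++ v ++ x) = f (u ++ l ++ v ++ x ++ y)].

Lemma pumpable_ctx u al w l' r' be :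
  steps be (terminals l' ++ al ++ terminals r') ->
  pumpable (u ++ l') al w -> pumpable u be (l' ++ w ++ r').
Proof.
move=> st [A [l [v [x [y [r [-> vy [s1 s2 s3] f1 f2]]]]]]].
exists A, (l' ++ l), v, x, y, (r ++ r'); rewrite -!catA.
split=> //; last 2 first.
- by rewrite -!catA in f1.
- by rewrite -!catA in f2.
split=> //; apply: rt_trans st _.
rewrite /terminals !map_cat -!catA -cat_cons [X in steps _ (_ ++ X)]catA.
by apply: steps_ctx s1.
Qed.

(** Build the tree bottom-up. If the key of a new root occurs below it, the
    factors between the two nodes can be pumped unless both are empty; in that
    case the subtree at the lower node spans the same factor and replaces the
    whole tree, which keeps it thin. *)
Lemma pumpable_or_thin u al w :
  derives al w -> pumpable u al w \/ thin finset.setT u al w.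
Proof.
move=> d; elim: d u => {al w}.
- by move=> u; right; constructor.
- move=> a al w _ IH u; case: (IH (rcons u a)) => [p|d]; last by right; constructor.
  left; rewrite -[a :: w]/([:: a] ++ w) -[w]cats0.
  by apply: (@pumpable_ctx _ al); rewrite ?cats1 //= cats0; apply: rt_refl.
- move=> A r al w1 w2 Ar d1 IH1 d2 IH2 u.
  have sA : steps [:: inl A] r by apply: steps_prod Ar (rt_refl _ _ _).
  have lift p : steps r p -> steps (inl A :: al) (p ++ terminals w2).
    by move=> rp; apply: (@steps_cat [:: inl A]) (derives_steps d2); apply: rt_trans sA rp.
  have [p|t2] := IH2 (u ++ w1).
    left; rewrite -[w1 ++ w2]cats0 -catA; apply: pumpable_ctx p.
    rewrite cats0 -cat1s; apply: steps_cat (rt_refl _ _ _).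
    exact: rt_trans sA (derives_steps d1).
  have [p|t1] := IH1 u.
    left; rewrite -[w1 ++ w2]/([::] ++ w1 ++ w2); apply: (@pumpable_ctx _ r).
      exact: lift (rt_refl _ _ _).
    by rewrite cats0.
  have [t1'|[B [v [w' [y [ew [<- e1 e2] st tB]]]]]] :=
    thin_avoid (key_of A u w1) t1.
    by right; apply: thin_prod Ar t1' t2; rewrite inE.
  have [vy|] := posnP (size (v ++ y)).
    right; rewrite -cat1s; apply: thin_cat t2.
    by move: vy tB; rewrite ew; case: v {ew e1 e2 st}; case: y => //= _; rewrite !cats0.
  move=> vy; left; exists A, [::], v, w', y, w2; rewrite ew in e2 *.
  rewrite /= cats0 -!catA in e1 e2 *; split=> //; split.
  - exact: (@steps_cat [:: inl A] [:: inl A] _ _ (rt_refl _ _ _) (derives_steps d2)).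
  - exact: rt_trans sA st.
  - exact: thin_steps tB.
Qed.

End Derivations.

Definition pow (T : Type) (v : seq T) t := flatten (nseq t v).

Lemma powSr (T : Type) (v : seq T) t : pow v t ++ v = pow v t.+1.
Proof. by elim: t => [|t IH]; rewrite /pow /= ?cats0 // -catA -/(pow v t) IH. Qed.

(** With [f] constant this is the usual pumping lemma without a bound on the
    pumped factors. Taking for [f] the state of an automaton after a prefix, both
    pumped factors become loops of the automaton, so this also replaces the
    closure of context-free languages under intersection with regular ones. *)
Lemma coloured_pumping (T Q : finType) (f : seq T -> Q) (L : set (seq T)) :
  context_free L -> exists N, forall w, L w -> N <= size w ->
  exists u v x y z, [/\ w = u ++ v ++ x ++ y ++ z, 0 < size (v ++ y),
    f u = f (u ++ v), f (u ++ v ++ x) = f (u ++ v ++ x ++ y) &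
    forall t, L (u ++ pow v t ++ x ++ pow y t ++ z)].
Proof.
case=> g <-; exists (rhs_bound g ^ #|{: nonterminal g * Q * Q}|).+1 => w Lw Nw.
have [p|t] := pumpable_or_thin f [::] (steps_derives Lw); last first.
  by have := thin_size t; rewrite cardsT mul1n leqNgt Nw.
case: p => A [u [v [x [y [z [-> vy [s1 s2 s3] f1 f2]]]]]].
exists u, v, x, y, z; split=> // t.
have sv : clos_refl_trans _ (@cfg_step T g) [:: inl A]
    (terminals g (pow v t) ++ inl A :: terminals g (pow y t)).
  elim: t => [|t IH]; first exact: rt_refl.
  have := steps_ctx (terminals g (pow v t)) (terminals g (pow y t)) s2.
  by rewrite -catA /= -map_cat catA -map_cat powSr; apply: rt_trans IH.
apply: rt_trans s1 _; have := steps_ctx (terminals g (pow v t)) (terminals g (pow y t)) s3.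
move=> /(rt_trans _ _ _ _ _ sv) /(steps_ctx (terminals g u) (terminals g z)).
by rewrite /terminals -!map_cat -!catA.
Qed.

(** * Mirror images of context-free languages *)

Section Mirror.
Variables (T : finType) (h : T -> T).
Hypothesis hK : involutive h.

Definition mirror (w : seq T) := rev (map h w).

Definition mirror_symbol (N : Type) (c : N + T) : N + T :=
  match c with inl A => inl A | inr a => inr (h a) end.

Definition mirror_form (N : Type) (al : seq (N + T)) :=
  rev (map (@mirror_symbol N) al).

Lemma mirrorK : involutive mirror.
Proof. by move=> w; rewrite /mirror map_rev revK (mapK hK). Qed.

Definition mirror_cfg (g : cfg T) : cfg T :=
  CFG (start g) [seq (p.1, mirror_form p.2) | p <- productions g].

Lemma mirror_step (g : cfg T) al be : cfg_step (g := g) al be ->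
  cfg_step (g := mirror_cfg g) (mirror_form al) (mirror_form be).
Proof.
move=> [u [v [A [r [Ar -> ->]]]]].
exists (mirror_form v), (mirror_form u), A, (mirror_form r); split.
- by apply/mapP; exists (A, r).
- by rewrite /mirror_form map_cat rev_cat /= rev_cons cat_rcons.
- by rewrite /mirror_form !map_cat !rev_cat catA.
Qed.

Lemma mirror_language (g : cfg T) w :
  cfg_language g w -> cfg_language (mirror_cfg g) (mirror w).
Proof.
rewrite /cfg_language /=; set be := map inr w => st.
have -> : map inr (mirror w) = mirror_form be :> seq (nonterminal g + T).
  by rewrite /mirror /mirror_form map_rev -!map_comp.
change [:: inl (start g)] with (mirror_form [:: inl (start g)] : seq (_ + T)).
elim: st => [x y xy|x|x y z _ xy _ yz].
- exact/rt_step/mirror_step.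
- exact: rt_refl.
- exact: rt_trans yz.
Qed.

Lemma mirror_cfgK (g : cfg T) : mirror_cfg (mirror_cfg g) = g.
Proof.
case: g => N s ps; congr CFG; rewrite /= -map_comp -[RHS]map_id.
apply: eq_map => -[A r] /=; congr pair; rewrite /mirror_form map_rev revK mapK //.
by case=> //= a; rewrite hK.
Qed.

Lemma context_free_mirror (L : set (seq T)) :
  context_free L -> context_free [set w | L (mirror w)]%classic.
Proof.
case=> g <-; exists (mirror_cfg g); apply/seteqP; split=> w /=.
  by move/mirror_language; rewrite mirror_cfgK.
by move/mirror_language; rewrite mirrorK.
Qed.
End Mirror.

(** * Walks in the Cayley tree of the free group *)

Section Walks.
Variable X : finType.
Local Notation L := (letter X).
Local Notation inv := (@letter_inv X).
Implicit Types (a c : L) (s t u v w : seq L).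

Lemma letter_invK : involutive inv.
Proof. by case. Qed.

Lemma letter_inv_neq a : inv a != a.
Proof. by case: a. Qed.

Lemma word_invE w : word_inv w = mirror inv w. Proof. by []. Qed.

Lemma word_invK w : word_inv (word_inv w) = w.
Proof. exact: mirrorK letter_invK w. Qed.

Lemma word_inv_cat u v : word_inv (u ++ v) = word_inv v ++ word_inv u.
Proof. by rewrite /word_inv map_cat rev_cat. Qed.

Lemma word_inv_cons a w : word_inv (a :: w) = word_inv w ++ [:: inv a].
Proof. by rewrite /word_inv /= rev_cons cats1. Qed.

Lemma word_inv_nseq k a : word_inv (nseq k a) = nseq k (inv a).
Proof. by rewrite /word_inv map_nseq rev_nseq. Qed.

Lemma size_word_inv w : size (word_inv w) = size w.
Proof. by rewrite size_rev size_map. Qed.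

(** A vertex of the Cayley tree is a reduced word stored with its last letter
   first, and a letter moves to the neighbouring vertex. *)
Definition step s a :=
  match s with c :: s' => if c == inv a then s' else a :: s | [::] => [:: a] end.
Definition run s w := foldl step s w.
Definition reduced s := sorted (fun a c => c != inv a) s.

Lemma run_cat s u v : run s (u ++ v) = run (run s u) v.
Proof. exact: foldl_cat. Qed.

Lemma reduced_step s a : reduced s -> reduced (step s a).
Proof.
case: s => [//|c s] /=; case: ifPn => [_|ca] rs; first exact: path_sorted rs.
by rewrite /= ca.
Qed.

Lemma reduced_run s w : reduced s -> reduced (run s w).
Proof. by elim: w s => [//|a w IH] s rs; apply: IH; apply: reduced_step. Qed.

Lemma stepK s a : reduced s -> step (step s a) (inv a) = s.
Proof.
case: s => [|c s] /=; first by rewrite letter_invK eqxx.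
case: eqP => [->|_ _]; last by rewrite /= letter_invK eqxx.
by case: s => [//|d s] /=; rewrite letter_invK; case: eqP.
Qed.

Lemma run_invK s w : reduced s -> run (run s w) (word_inv w) = s.
Proof.
elim: w s => [//|a w IH] s rs.
rewrite word_inv_cons run_cat (IH (step s a)); first exact: stepK.
exact: reduced_step.
Qed.

Definition visits s w t := exists2 k, k <= size w & run s (take k w) = t.

Lemma visits_cat s u v t :
  visits s (u ++ v) t <-> visits s u t \/ visits (run s u) v t.
Proof.
split=> [[k lek <-]|[[k lek <-]|[k lek <-]]].
- case: (leqP k (size u)) => ku; first by left; exists k; rewrite ?takel_cat.
  right; exists (k - size u); first by rewrite size_cat in lek; lia.
  by rewrite take_cat ltnNge (ltnW ku) /= run_cat.
- by exists k; rewrite ?takel_cat // size_cat; lia.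
- exists (size u + k); first by rewrite size_cat leq_add2l.
  by rewrite -run_cat take_cat ltnNge leq_addr /= addKn.
Qed.

(** Reading [u] and then its inverse retraces the same edges. *)
Lemma visits_inv s u t : reduced s -> visits (run s u) (word_inv u) t <-> visits s u t.
Proof.
move=> rs; have aux v s' : reduced s' -> visits (run s' v) (word_inv v) t -> visits s' v t.
  move=> rs' [k]; rewrite size_word_inv => lek <-; exists (size v - k); first lia.
  have e : v = take (size v - k) v ++ drop (size v - k) v by rewrite cat_take_drop.
  rewrite [in RHS]e word_inv_cat run_cat take_size_cat; last first.
    by rewrite size_word_inv size_drop; lia.
  by rewrite run_invK //; apply: reduced_run.
split; first exact: aux.
by move=> h; apply: aux; [exact: reduced_run | rewrite word_invK run_invK].
Qed.

Lemma visits_end s w : visits s w (run s w).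
Proof. by exists (size w); rewrite ?take_size. Qed.

Lemma run_idem s u : reduced s -> run s (u ++ word_inv u) = s.
Proof. by move=> rs; rewrite run_cat run_invK. Qed.

Lemma visits_idem s u t : reduced s -> visits s (u ++ word_inv u) t <-> visits s u t.
Proof. by move=> rs; rewrite visits_cat visits_inv //; tauto. Qed.

Lemma run_idem2 u v s : reduced s ->
  run s (u ++ word_inv u ++ v ++ word_inv v) = s /\
  forall t, visits s (u ++ word_inv u ++ v ++ word_inv v) t <-> visits s u t \/ visits s v t.
Proof.
move=> rs; rewrite catA; split=> [|t]; first by rewrite run_cat !run_idem.
by rewrite visits_cat run_idem // !visits_idem.
Qed.

(** The easy half of Munn's theorem: vagner-equivalent words have walks with the
    same end and the same vertices. *)
Lemma vagner_run (u v : word X) s : vagner u v -> reduced s ->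
  run s u = run s v /\ forall t, visits s u t <-> visits s v t.
Proof.
move=> uv; elim: uv s => {u v}.
- move=> u s rs; rewrite catA run_cat run_idem //; split=> // t.
  by rewrite visits_cat run_idem // visits_idem //; tauto.
- move=> u v s rs; have [-> uv] := run_idem2 u v rs; have [-> vu] := run_idem2 v u rs.
  by split=> // t; rewrite uv vu; tauto.
- by move=> *; split.
- by move=> u v _ IH s /IH [-> h]; split=> // t; rewrite h.
- by move=> u v w _ IH1 _ IH2 s rs; have [-> h1] := IH1 s rs;
    have [-> h2] := IH2 s rs; split=> // t; rewrite h1.
- move=> u u' v v' _ IH1 _ IH2 s rs; have [e1 h1] := IH1 s rs.
  have [e2 h2] := IH2 _ (reduced_run u rs).
  by rewrite !run_cat e2 e1; split=> // t; rewrite !visits_cat h1 h2 e1.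
Qed.

(** A word moves every vertex as its free reduction does: the action of words on
    vertices factors through the free group. *)
Lemma run_reduce s w : reduced s -> run s w = run s (rev (run [::] w)).
Proof.
move=> rs; elim/last_ind: w => [//|w a IH].
rewrite -cats1 !run_cat IH /=; set r := run [::] w.
case: r => [//|c r] /=; case: eqP => [->|_]; last first.
  by rewrite [in RHS]rev_cons -cats1 run_cat.
rewrite rev_cons -cats1 run_cat /= -[X in step _ X]letter_invK stepK //.
exact: reduced_run.
Qed.

Lemma run_catl s w : reduced s -> run (run [::] (word_inv (rev s))) (rev s ++ w) = run [::] w.
Proof.
move=> rs; rewrite run_cat; congr run.
by rewrite -{2}[rev s]word_invK run_invK.
Qed.

Lemma run_rev s : reduced s -> run [::] (rev s) = s.
Proof.
elim: s => [//|a s IH] rs; rewrite rev_cons -cats1 run_cat IH; last exact: path_sorted rs.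
by case: s rs {IH} => [//|c s] /= /andP [/negbTE-> _].
Qed.

Lemma run_cancel s u v : reduced s -> run s u = run s v -> run [::] u = run [::] v.
Proof.
move=> rs uv; rewrite -(run_catl u rs) -(run_catl v rs).
have r0 : reduced (run [::] (word_inv (rev s))) by apply: reduced_run.
by rewrite (run_reduce (rev s ++ u) r0) (run_reduce (rev s ++ v) r0) !run_cat run_rev // uv.
Qed.

Lemma size_run s w : size (run s w) <= size s + size w.
Proof.
elim: w s => [|a w IH] s /=; first by rewrite addn0.
apply: leq_trans (IH _) _; rewrite addnS -addSn leq_add2r.
by case: s => [//|c s] /=; case: ifP => //= _; lia.
Qed.

(** A walk that moves away from the start as far as its length allows never
    cancels. *)
Lemma run_size_eq s w : size (run s w) = size s + size w -> run s w = rev w ++ s.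
Proof.
elim: w s => [//|a w IH] s /= e.
have es : step s a = a :: s.
  case: s e => [//|c s] /=; case: eqP => //= _ e.
  by have := size_run s w; rewrite e addSn addnS ltnNge leqnSn.
by rewrite es in e *; rewrite rev_cons cat_rcons -IH // e /= addSnnS.
Qed.

(** A reduced path is the unique shortest walk between its ends. *)
Lemma walk_size s u v : reduced s -> reduced (rev u) -> run s v = run s u ->
  size u <= size v /\ (size u = size v -> v = u).
Proof.
move=> rs ru /(run_cancel rs); rewrite -{1}[u]revK run_rev // => e.
split=> [|uv]; first by rewrite -(size_rev u) -e size_run.
by apply: (can_inj (@revK _)); rewrite -e run_size_eq ?cats0 // e size_rev uv.
Qed.

Lemma run_take w i j : i <= j ->
  run [::] (take j w) = run (run [::] (take i w)) (drop i (take j w)).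
Proof. by move=> ij; rewrite -run_cat -(take_takel w ij) cat_take_drop. Qed.

Lemma geodesic_segment w u i j : i <= j -> j <= size w -> reduced (rev u) ->
  run (run [::] (take i w)) u = run [::] (take j w) -> j - i = size u ->
  take j w = take i w ++ u.
Proof.
move=> ij jw ru e su; rewrite (run_take _ ij) in e.
have r0 : reduced (run [::] (take i w)) by apply: reduced_run.
have [_ <-] := walk_size r0 ru (esym e).
  by rewrite -{1}(take_takel w ij) cat_take_drop.
by rewrite size_drop size_takel.
Qed.

(** The times [i] and [j] come in either order; for [j < i] the inverse of the
    segment walked between them joins the two vertices the other way. *)
Lemma walk_dist w i j u : i <= size w -> j <= size w -> reduced (rev u) ->
  run (run [::] (take i w)) u = run [::] (take j w) ->
  (size u <= (j - i) + (i - j)).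
Proof.
move=> iw jw ru.
have rd k : reduced (run [::] (take k w)) by exact: reduced_run.
case: (leqP i j) => ij e.
  rewrite (run_take _ ij) in e; have [] := walk_size (rd i) ru (esym e).
  by rewrite size_drop size_takel //; lia.
have e' : run (run [::] (take i w)) (word_inv (drop j (take i w))) = run [::] (take j w).
  by rewrite (run_take _ (ltnW ij)) run_invK.
rewrite -e' in e; have [] := walk_size (rd i) ru (esym e).
by rewrite size_word_inv size_drop size_takel //; lia.
Qed.

Lemma run_nseq a k s : (forall c s', s = c :: s' -> c != inv a) ->
  run s (nseq k a) = nseq k a ++ s.
Proof.
elim: k s => [//|k IH] s h; rewrite -[nseq k.+1 a]/(a :: nseq k a) /run /= -/(run _ _).
have -> : step s a = a :: s.
  by case: s h => [//|c s] h /=; rewrite (negbTE (h _ _ erefl)).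
rewrite IH; last by move=> c s' [<- _]; rewrite eq_sym letter_inv_neq.
by rewrite -cat_rcons -cats1 -[[:: a]]/(nseq 1 a) -nseqD addn1.
Qed.

Lemma run_nseq_inv a k s : run (nseq k a ++ s) (nseq k (inv a)) = s.
Proof. by elim: k => [//|k IH] /=; rewrite letter_invK eqxx. Qed.

Lemma reduced_nseq a k s : reduced s -> (forall c s', s = c :: s' -> c != inv a) ->
  reduced (nseq k a ++ s).
Proof. by move=> rs h; rewrite -run_nseq //; apply: reduced_run. Qed.

End Walks.

(** * Green's relations on words *)

Local Open Scope classical_set_scope.

Section Green.
Variable X : finType.
Local Notation inv := (@letter_inv X).
Local Notation FR := (@greenR (FIM X)).
Local Notation FL := (@greenL (FIM X)).
Implicit Types (u v w : word X).

Lemma greenRP u v : FR (fim_pi u) (fim_pi v) <->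
  (exists s, vagner u (v ++ s)) /\ (exists s, vagner v (u ++ s)).
Proof.
split=> [e|[[s us] [r vr]]].
  have aux a b : range (fun s => (fim_pi a * s)%g) `<=` range (fun s => (fim_pi b * s)%g) ->
      exists s, vagner a (b ++ s).
    move=> h; have [|s _] := h (fim_pi a); first by exists 1%g => //; rewrite mulg1.
    rewrite -(fim_pi_repr s) -fim_piM => es; exists (repr s); exact/fim_piP/esym.
  by split; apply: aux; rewrite e.
have aux a b s0 : vagner a (b ++ s0) ->
    range (fun s => (fim_pi a * s)%g) `<=` range (fun s => (fim_pi b * s)%g).
  move=> /fim_piP; rewrite fim_piM => -> _ [t _ <-].
  by exists (fim_pi s0 * t)%g => //; rewrite mulgA.
by apply/seteqP; split; apply: aux; eassumption.
Qed.

Lemma greenLP u v : FL (fim_pi u) (fim_pi v) <->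
  (exists s, vagner u (s ++ v)) /\ (exists s, vagner v (s ++ u)).
Proof.
split=> [e|[[s us] [r vr]]].
  have aux a b : range (fun s => (s * fim_pi a)%g) `<=` range (fun s => (s * fim_pi b)%g) ->
      exists s, vagner a (s ++ b).
    move=> h; have [|s _] := h (fim_pi a); first by exists 1%g => //; rewrite mul1g.
    rewrite -(fim_pi_repr s) -fim_piM => es; exists (repr s); exact/fim_piP/esym.
  by split; apply: aux; rewrite e.
have aux a b s0 : vagner a (s0 ++ b) ->
    range (fun s => (s * fim_pi a)%g) `<=` range (fun s => (s * fim_pi b)%g).
  move=> /fim_piP; rewrite fim_piM => -> _ [t _ <-].
  by exists (t * fim_pi s0)%g => //; rewrite mulgA.
by apply/seteqP; split; apply: aux; eassumption.
Qed.

Lemma vagner_inv u v : vagner u v -> vagner (word_inv u) (word_inv v).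
Proof.
elim=> {u v}.
- move=> u; rewrite !word_inv_cat word_invK -catA.
  by have := vagner_regular (word_inv u); rewrite word_invK.
- move=> u v; rewrite !word_inv_cat !word_invK -!catA; exact: vagner_commute.
- by move=> u; apply: vagner_refl.
- by move=> u v _; apply: vagner_sym.
- by move=> u v w _ IH1 _; apply: vagner_trans.
- by move=> u u' v v' _ IH1 _ IH2; rewrite !word_inv_cat; apply: vagner_cat.
Qed.

Lemma green_dual u v :
  FL (fim_pi u) (fim_pi v) <-> FR (fim_pi (word_inv u)) (fim_pi (word_inv v)).
Proof.
rewrite greenLP greenRP; split=> -[[s us] [r vr]]; split.
- by exists (word_inv s); rewrite -word_inv_cat; apply: vagner_inv.
- by exists (word_inv r); rewrite -word_inv_cat; apply: vagner_inv.
- exists (word_inv s); move/vagner_inv: us.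
  by rewrite word_inv_cat !word_invK.
- exists (word_inv r); move/vagner_inv: vr.
  by rewrite word_inv_cat !word_invK.
Qed.

Lemma Geo_dual w : Geo FL w <-> Geo FR (word_inv w).
Proof.
split=> -[_ m]; split.
- by exists (word_inv w).
- move=> _ [u uw <-]; rewrite size_word_inv -(size_word_inv u); apply: m.
  by exists (word_inv u) => //=; apply/green_dual; rewrite word_invK.
- by exists w.
- move=> _ [u uw <-]; rewrite -(size_word_inv w) -(size_word_inv u); apply: m.
  by exists (word_inv u) => //=; apply/green_dual.
Qed.

End Green.

(** * Tours and their exponents *)

Section Witness.
Variables (X : finType) (x y : X).
Hypothesis xy : x != y.
Local Notation b := (inl x : letter X).
Local Notation B := (inr x : letter X).
Local Notation a := (inl y : letter X).
Local Notation FR := (@greenR (FIM X)).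

(** The second letter only closes the hair at the root; the branch is [b^i]. *)
Definition tour i j k : seq (letter X) :=
  B :: b :: nseq i b ++ nseq j B ++ nseq k a.

Lemma size_tour i j k : size (tour i j k) = i + j + k + 2.
Proof. by rewrite /= !size_cat !size_nseq; lia. Qed.

Lemma reduced_rev2 p q (c d : letter X) : c != letter_inv d ->
  reduced (rev (nseq p c ++ nseq q d)).
Proof.
move=> cd; rewrite rev_cat !rev_nseq; apply: reduced_nseq; last by case: p => //= p _ _ [<- _].
by rewrite -[nseq p c]cats0; apply: reduced_nseq.
Qed.

Lemma run_hair_branch k : run [:: B] (nseq k.+1 b) = nseq k b.
Proof. by rewrite /run /= eqxx -/(run _ _) run_nseq ?cats0. Qed.

Lemma run_branch_trunk k : run [:: b] (nseq k a) = nseq k a ++ [:: b].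
Proof. by rewrite run_nseq // => c s [<- _]. Qed.

Lemma run_fork n : run (nseq n.+1 b) (nseq n B ++ nseq n.+1 a) = nseq n.+1 a ++ [:: b].
Proof. by rewrite run_cat -addn1 nseqD (run_nseq_inv b) addn1 run_branch_trunk. Qed.

Lemma tour_visits n : let w := tour n.+1 n n.+1 in
  [/\ visits [::] w [:: B], visits [::] w (nseq n.+1 b) &
      visits [::] w (nseq n.+1 a ++ [:: b])].
Proof.
move=> w; rewrite {}/w -[tour _ _ _]/([:: B] ++ nseq n.+2 b ++ nseq n B ++ nseq n.+1 a).
split; first by apply/visits_cat; left; exact: (visits_end [::] [:: B]).
  apply/visits_cat; right; apply/visits_cat; left.
  by rewrite -[X in visits _ _ X](run_hair_branch n.+1); apply: visits_end.
have := visits_end [::] ([:: B] ++ nseq n.+2 b ++ nseq n B ++ nseq n.+1 a).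
by rewrite run_cat (run_cat (run _ _) (nseq n.+2 b)) (run_hair_branch n.+1) run_fork.
Qed.

(** Only the times [h], [q] and [s] of passage at the three leaves matter: the
    distances between the leaves leave [h < q < s] as the only order within the
    allowed length, and in this order each leg is as short as a reduced path. *)
Lemma tour_unique n (w : seq (letter X)) :
  visits [::] w [:: B] -> visits [::] w (nseq n.+1 b) ->
  visits [::] w (nseq n.+1 a ++ [:: b]) -> size w <= size (tour n.+1 n n.+1) ->
  w = tour n.+1 n n.+1.
Proof.
rewrite size_tour => -[h hw eh] [q qw eq] [s sw es] sz.
have bB : b != letter_inv a by [].
have run1 : run [::] (nseq 1 B ++ nseq 0 a) = [:: B] by [].
have run2 k : run [::] (nseq k b ++ nseq 0 a) = nseq k b.
  by rewrite /= cats0 run_nseq ?cats0.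
have run3 : run [::] (nseq 1 b ++ nseq n.+1 a) = nseq n.+1 a ++ [:: b].
  by rewrite run_cat run_branch_trunk.
have run4 : run [:: B] (nseq n.+2 b ++ nseq 0 a) = nseq n.+1 b.
  by rewrite cats0 run_hair_branch.
have run5 : run [:: B] (nseq 2 b ++ nseq n.+1 a) = nseq n.+1 a ++ [:: b].
  by rewrite run_cat run_hair_branch run_branch_trunk.
have T0 : run [::] (take 0 w) = [::] by rewrite take0.
have rBa : B != letter_inv a by rewrite /=; apply: contra xy => /eqP [->].
have d1 : 1 <= (h - 0) + (0 - h).
  by have := @walk_dist _ w 0 h _ isT hw (reduced_rev2 1 0 rBa); rewrite T0 eh run1; apply.
have d2 : n.+1 <= (q - 0) + (0 - q).
  have := @walk_dist _ w 0 q _ isT qw (reduced_rev2 n.+1 0 bB); rewrite T0 eq run2.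
  by rewrite size_cat !size_nseq addn0; apply.
have d3 : n.+2 <= (s - 0) + (0 - s).
  have := @walk_dist _ w 0 s _ isT sw (reduced_rev2 1 n.+1 bB); rewrite T0 es run3.
  by rewrite size_cat !size_nseq; apply.
have d4 : n.+2 <= (q - h) + (h - q).
  have := walk_dist hw qw (reduced_rev2 n.+2 0 bB); rewrite eh eq run4.
  by rewrite size_cat !size_nseq addn0; apply.
have d5 : n.+3 <= (s - h) + (h - s).
  have := walk_dist hw sw (reduced_rev2 2 n.+1 bB); rewrite eh es run5.
  by rewrite size_cat !size_nseq; apply.
have d6 : n + n.+1 <= (s - q) + (q - s).
  have := walk_dist qw sw (reduced_rev2 n n.+1 rBa); rewrite eq es run_fork.
  by rewrite size_cat !size_nseq; apply.
(* All visiting orders other than hair, branch, trunk exceed the length. *)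
have [h1 [q1 s1]] : h = 1 /\ q = n.+3 /\ s = size w by lia.
have sz' : size w = 3 * n + 4 by lia.
have t1 : take h w = [:: B].
  have := @geodesic_segment _ w (nseq 1 B ++ nseq 0 a) 0 h isT hw (reduced_rev2 1 0 rBa).
  by rewrite T0 take0 eh h1; apply.
have t2 : take q w = [:: B] ++ nseq n.+2 b ++ nseq 0 a.
  rewrite -t1; apply: (geodesic_segment _ qw (reduced_rev2 n.+2 0 bB)); first lia.
    by rewrite eh eq run4.
  by rewrite size_cat !size_nseq h1 q1; lia.
have t3 : take s w = take q w ++ nseq n B ++ nseq n.+1 a.
  apply: (geodesic_segment _ sw (reduced_rev2 n n.+1 rBa)); first lia.
    by rewrite eq es run_fork.
  by rewrite size_cat !size_nseq s1 q1 sz'; lia.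
by rewrite -[w]take_size -s1 t3 t2 /tour /= cats0.
Qed.

Lemma Geo_le (w u : word X) : Geo FR w -> FR (fim_pi u) (fim_pi w) -> size w <= size u.
Proof. by move=> [_ m] uw; apply: m; exists u. Qed.

Lemma greenR_vagner (u v : word X) : vagner u v -> FR (fim_pi u) (fim_pi v).
Proof. by move/fim_piP->. Qed.

(** Both sides cover the tree of [u] and [v] side by side; they differ only in
    the branch on which the walk ends. *)
Lemma greenR_swap (p u v : word X) :
  FR (fim_pi (p ++ u ++ word_inv u ++ v)) (fim_pi (p ++ v ++ word_inv v ++ u)).
Proof.
have aux (s t : word X) : vagner (p ++ s ++ word_inv s ++ t)
    ((p ++ t ++ word_inv t ++ s) ++ word_inv s ++ t).
  apply: vagner_sym; rewrite -!catA; apply: vagner_cat; first exact: vagner_refl.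
  have c := vagner_cat (vagner_commute t s) (vagner_refl t); rewrite -!catA in c.
  apply: vagner_trans c _; do 2![apply: vagner_cat; first exact: vagner_refl].
  exact: vagner_regular.
by apply/greenRP; split; eexists; apply: aux.
Qed.

(** Both bounds come from shorter words in the same R-class: when [i < j] the
    idempotents of the hair and of the branch commute, and the hair visited
    again by the descent absorbs the first visit; when [k < j] the walk may end
    on the longer branch instead. *)
Lemma Geo_tour i j k : Geo FR (tour i j k) -> j <= i /\ j <= k.
Proof.
move=> geo; have ji : j <= i.
  rewrite leqNgt; apply/negP => ij.
  have ej : nseq j B = nseq i B ++ [:: B] ++ nseq (j - i.+1) B.
    by rewrite -[[:: B]]/(nseq 1 B) -!nseqD; congr nseq; lia.
  suff : vagner (nseq i b ++ nseq j B ++ nseq k a : word X) (tour i j k).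
    by move/greenR_vagner/(Geo_le geo); rewrite /= ltnNge leqnSn.
  rewrite /tour ej -[B :: b :: _]/([:: B; b] ++ _) !catA.
  do 2![apply: vagner_cat; last exact: vagner_refl].
  apply: vagner_sym; rewrite -!catA.
  have c := vagner_cat (vagner_commute [:: B] (nseq i b)) (vagner_refl [:: B]).
  rewrite word_inv_nseq -!catA in c; apply: vagner_trans c _.
  do 2![apply: vagner_cat; first exact: vagner_refl].
  exact: (vagner_regular [:: B]).
split=> //.
have et : tour i j k = (B :: b :: nseq (i - j) b) ++ nseq j b ++ nseq j B ++ nseq k a.
  by rewrite /tour /= [in RHS]catA -nseqD subnK.
have := greenR_swap (B :: b :: nseq (i - j) b) (nseq k a) (nseq j b).
rewrite !word_inv_nseq -et => /(Geo_le geo).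
by rewrite size_tour /= !size_cat !size_nseq; lia.
Qed.

(** The automaton of [B b b* B* a*]; the state 5 is a sink. The states only grow
   along a word, which is what confines a loop to a single block. *)
Definition phase_step (s : nat) (c : letter X) : nat :=
  match s with
  | 0 => if c == B then 1 else 5
  | 1 => if c == b then 2 else 5
  | 2 => if c == b then 2 else if c == B then 3 else 5
  | 3 => if c == B then 3 else if c == a then 4 else 5
  | 4 => if c == a then 4 else 5
  | _ => 5
  end.

Definition phase s (w : seq (letter X)) := foldl phase_step s w.

Lemma phase_cat s u v : phase s (u ++ v) = phase (phase s u) v.
Proof. exact: foldl_cat. Qed.

Lemma phase_step_ge s c : s <= 5 -> s <= phase_step s c <= 5.
Proof. by do 6?[case: s => [|s]]; rewrite //=; do ?case: ifP. Qed.

Lemma phase_ge s w : s <= 5 -> s <= phase s w <= 5.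
Proof.
elim: w s => [|c w IH] s s5 /=; first by rewrite leqnn.
have /andP[h1 h2] := phase_step_ge c s5; have /andP[h3 h4] := IH _ h2.
by rewrite h4 (leq_trans h1 h3).
Qed.

(** Since states never decrease, a loop stays in one state, and each state below
    the sink loops on at most one letter. *)
Lemma phase_loop s v : s < 5 -> phase s v = s ->
  exists2 c, c \in [:: b; B; a] & all (pred1 c) v.
Proof.
(* In the states 0 and 1 only the empty word loops, so the first two entries
   are arbitrary. *)
move=> s5 e; exists (nth b [:: b; b; b; B; a] s).
  by do 5?[case: s s5 e => [|s] s5 e]; rewrite ?inE ?eqxx ?orbT.
elim: v e => [//|c v IH] /= e.
have /andP[h1 h2] := phase_step_ge c (ltnW s5).
have /andP[h3 h4] := phase_ge v h2.
have es : phase_step s c = s by apply/eqP; rewrite eqn_leq h1 andbT -{2}e.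
rewrite IH ?andbT; last by rewrite -{2}e /= es.
move: es s5 {IH e h1 h2 h3 h4}.
by do 5?[case: s => [|s]]; rewrite //=; do ?[case: eqP => //].
Qed.

Lemma phase_tour i j k : phase 0 (tour i j.+1 k.+1) = 4.
Proof.
have stay p c m : phase_step p c = p -> phase p (nseq m c) = p.
  by move=> e; elim: m => //= m; rewrite e.
have enter p c p' m : phase_step p c = p' -> phase_step p' c = p' ->
    phase p (c :: nseq m c) = p' by move=> e e'; rewrite /phase /= e; apply: stay.
rewrite -[tour _ _ _]/([:: B; b] ++ nseq i b ++ (B :: nseq j B) ++ (a :: nseq k a)).
rewrite !phase_cat; have -> : phase 0 [:: B; b] = 2 by rewrite /phase /= eqxx /= eqxx.
by rewrite stay ?(enter 2 B 3) ?(enter 3 a 4) //= eqxx.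
Qed.

Lemma phase_form w : phase 0 w = 4 -> exists i j k, w = tour i j k.
Proof.
pose form s (w : seq (letter X)) := match s with
  | 0 => w = [::] | 1 => w = [:: B]
  | 2 => exists i, w = tour i 0 0
  | 3 => exists i j, w = tour i j 0
  | 4 => exists i j k, w = tour i j k
  | _ => True end.
suff : form (phase 0 w) w by move=> + e; rewrite e.
elim/last_ind: w => [//|w c]; rewrite -cats1 phase_cat /=.
have sn n (d : letter X) : nseq n d ++ [:: d] = nseq n.+1 d.
  by rewrite -addn1 nseqD.
case: (phase 0 w) => [|[|[|[|[|?]]]]] //=.
- by move=> ->; case: eqP => [->|].
- by move=> ->; case: eqP => [->|] //; exists 0.
- move=> [i ->]; case: eqP => [->|_]; first by exists i.+1; rewrite /tour !cats0 /= sn.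
  by case: eqP => [->|] //; exists i, 1; rewrite /tour /= !cats0.
- move=> [i [j ->]]; case: eqP => [->|_].
    by exists i, j.+1; rewrite /tour !cats0 -sn /= -catA.
  by case: eqP => [->|] //; exists i, j, 1; rewrite /tour !cats0 /= -!catA.
- by move=> [i [j [k ->]]]; case: eqP => [->|] //; exists i, j, k.+1; rewrite /tour -sn /= -!catA.
Qed.

Lemma count_tour i j k : [/\ count_mem b (tour i j k) = i.+1,
  count_mem B (tour i j k) = j.+1 & count_mem a (tour i j k) = k].
Proof.
have ab : (inl x == a) = false by apply/negP => /eqP [e]; move: xy; rewrite e eqxx.
have ba : (inl y == b) = false by rewrite eq_sym.
by rewrite /tour /= !count_cat !count_nseq /= !eqxx ab ba /=; split; lia.
Qed.

Lemma count_pow (c : letter X) v t : count_mem c (pow v t) = t * count_mem c v.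
Proof. by elim: t => //= t IH; rewrite count_cat IH mulSn. Qed.

Lemma phase_pow s v t : phase s v = s -> phase s (pow v t) = s.
Proof. by move=> e; elim: t => //= t IH; rewrite phase_cat e. Qed.

(** The tours of parameters [n + 1], [n], [n + 1] belong to [K]; pumping one of
    them moves its exponents in a direction excluded by the bounds. *)
Lemma greenR_transversal_not_context_free (K : set (word X)) :
  K `<=` Geo FR ->
  (forall C, green_class FR C -> exists2 w, K w & C (fim_pi w)) ->
  ~ context_free K.
Proof.
move=> KG KC cf.
pose f (p : seq (letter X)) := (inord (phase 0 p) : 'I_6, odd (size p)).
have [N pump] := coloured_pumping f cf.
(* A positive [n] makes the run on the tour pass through every block. *)
pose n := N.+1; pose w := tour n.+1 n n.+1.
have Kw : K w.
  have [u Ku uw] : exists2 u, K u & FR (fim_pi u) (fim_pi w).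
    by apply: (KC [set c | FR c (fim_pi w)]); exists (fim_pi w).
  have vis t : visits [::] w t -> visits [::] u t.
    have /greenRP [[r ur] _] := uw; have [_ h] := vagner_run (s := [::]) ur isT.
    by move=> wt; apply/h/visits_cat; left.
  have [v1 v2 v3] := tour_visits n.
  have uw' := Geo_le (KG _ Ku) (esym uw : FR (fim_pi w) (fim_pi u)).
  by rewrite /w -(tour_unique (vis _ v1) (vis _ v2) (vis _ v3) uw').
have fP p q : f p = f q -> phase 0 p = phase 0 q /\ odd (size p) = odd (size q).
  have p5 r : phase 0 r < 6 by case/andP: (phase_ge r (isT : 0 <= 5)).
  by move=> [/(congr1 val)] /=; rewrite !inordK.
have [|u [v [m [t [z [ew vt /fP [pv ov] /fP [pt ot] Kpump]]]]]] := pump _ Kw.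
  by rewrite /w size_tour /n; lia.
have p4 : phase 0 w = 4 by apply: phase_tour.
have lt5 r r' : w = r ++ r' -> phase 0 r < 5.
  move=> e; rewrite e phase_cat in p4.
  have /andP[_ r5] := phase_ge r (isT : 0 <= 5).
  by have /andP[+ _] := phase_ge r' r5; rewrite p4.
have form c r r' : w = r ++ c ++ r' -> phase 0 r = phase 0 (r ++ c) ->
    odd (size r) = odd (size (r ++ c)) ->
    exists2 l, l \in [:: b; B; a] & exists k, c = nseq k.*2 l.
  move=> e; rewrite phase_cat => /esym pc; rewrite size_cat oddD.
  have [l lin /all_pred1P cl] := phase_loop (lt5 _ _ e) pc.
  move=> oc; exists l => //; exists (size c)./2.
  by rewrite even_halfK //; move: oc; case: odd; case: odd.
have [c cin [p ec]] := form v u _ ew pv ov.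
have [d din [q ed]] : exists2 l, l \in [:: b; B; a] & exists k, t = nseq k.*2 l.
  by apply: (form t (u ++ v ++ m) z); rewrite -!catA.
have bounds k : exists i j l, [/\ j <= i, j <= l &
  [/\ i.+1 + count_mem b (v ++ t) = n.+2 + k * count_mem b (v ++ t),
      j.+1 + count_mem B (v ++ t) = n.+1 + k * count_mem B (v ++ t) &
      l + count_mem a (v ++ t) = n.+1 + k * count_mem a (v ++ t)]].
  have pk : phase 0 (u ++ pow v k ++ m ++ pow t k ++ z) = 4.
    rewrite phase_cat in pv; rewrite !phase_cat -pv in pt.
    rewrite -p4 ew !phase_cat -pv -pt.
    by rewrite (phase_pow _ (esym pv)) (phase_pow _ (esym pt)).
  have [i [j [l e]]] := phase_form pk.
  have := Kpump k; rewrite e => /KG /Geo_tour [ji jl].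
  exists i, j, l; split=> //.
  have [c1 c2 c3] := count_tour i j l; have [w1 w2 w3] := count_tour n.+1 n n.+1.
  rewrite -e !count_cat !count_pow in c1 c2 c3.
  rewrite -/w ew !count_cat in w1 w2 w3.
  by rewrite !count_cat; split; lia.
(* Removing the factors bounds the changes of [i] and of [k] by that of [j] plus
   one; adding two copies bounds the change of [j] by each of the others. *)
have [i0 [j0 [l0 [ji0 jl0]]]] := bounds 0.
have [i3 [j3 [l3 [ji3 jl3]]]] := bounds 3.
have ab : (inl x == a) = false by apply/negP => /eqP [e]; move: xy; rewrite e eqxx.
have ba : (inl y == b) = false by rewrite eq_sym.
move: vt cin din; rewrite ec ed !count_cat !count_nseq size_cat !size_nseq !inE.
move=> vt /or3P[] /eqP -> /or3P[] /eqP -> /=; rewrite ?eqxx ?ab ?ba /= => -[? ? ?] [? ? ?]; lia.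
Qed.

End Witness.

(** * Representatives of Green classes *)

Section LexMin.
Variables (T : finType) (le : rel T).
Hypothesis le_order : total_order le.

Lemma le_min (P : T -> Prop) :
  (exists a, P a) -> exists2 a, P a & forall c, P c -> le a c.
Proof.
case: le_order => _ le_trans le_total [a0 Pa0].
suff main (s : seq T) : exists2 a, P a & forall c, c \in s -> P c -> le a c.
  by have [a Pa ma] := main (enum T); exists a => // c; apply: ma; rewrite mem_enum.
elim: s => [|d s [a Pa ma]]; first by exists a0.
have [[Pd da]|nPd] := pselect (P d /\ le d a).
  exists d => // c; rewrite inE => /orP[/eqP-> _|cs Pc].
    by case/orP: (le_total d d).
  exact: le_trans da (ma _ cs Pc).
exists a => // c; rewrite inE => /orP[/eqP-> Pd|]; last exact: ma.
by case/orP: (le_total a d) => // da; case: nPd.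
Qed.

(** Take a least possible first letter, then recurse on the words that start
    with it. *)
Lemma lex_min m (P : seq T -> Prop) : (exists2 u, size u = m & P u) ->
  exists2 w, size w = m /\ P w & forall u, size u = m -> P u -> lex le w u.
Proof.
elim: m P => [|m IH] P [u su Pu].
  by exists u => [//|v _ _]; case: u su {Pu}.
have [|a [v sv Pv] ma] := le_min (P := fun a => exists2 v, size v = m & P (a :: v)).
  by case: u su Pu => // a v [sv] Pv; exists a, v.
have [|w [sw Pw] mw] := IH (fun v => P (a :: v)); first by exists v.
exists (a :: w) => [|[//|c t] [st] Pt /=]; first by rewrite /= sw.
case: eqP => [e|_]; first by apply: mw; rewrite // e.
by apply: ma; exists t.
Qed.
End LexMin.

Section Representatives.
Variables (X : finType) (G : FIM X -> FIM X -> Prop).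
Hypothesis Grefl : forall p, G p p.
Hypothesis Gtrans : forall p q r, G p q -> G q r -> G p r.

Lemma class_min_size p : exists2 m, (exists2 u : word X, size u = m & G (fim_pi u) p) &
  forall u : word X, G (fim_pi u) p -> m <= size u.
Proof.
pose P m := `[< exists2 u : word X, size u = m & G (fim_pi u) p >].
have exP : exists m, P m.
  by exists (size (repr p)); apply/asboolP; exists (repr p); rewrite ?fim_pi_repr.
case: (ex_minnP exP) => m /asboolP [u um up] mm; exists m; first by exists u.
by move=> v vp; apply: mm; apply/asboolP; exists v.
Qed.

Lemma SL_meets_classes (le : rel (letter X)) C :
  total_order le -> green_class G C -> exists2 w, SL le G w & C (fim_pi w).
Proof.
move=> leo [p ->]; have [m exm mm] := class_min_size p.
have [w [sw wp] mw] := lex_min leo exm; exists w => // u uw.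
have up := Gtrans uw wp; rewrite /shortlex sw.
have := mm _ up; rewrite leq_eqVlt => /orP[/eqP e|-> //].
by rewrite e eqxx /= mw ?orbT.
Qed.

Lemma SL_sub_Geo (le : rel (letter X)) : SL le G `<=` Geo G.
Proof.
move=> w wm; split; first by exists w => //=; apply: Grefl.
move=> _ [u uw <-]; have := wm u uw.
by rewrite /shortlex => /orP[/ltnW //|/andP[/eqP-> _]].
Qed.

Lemma Geo_meets_classes C : green_class G C -> exists2 w, Geo G w & C (fim_pi w).
Proof.
move=> [p ->]; have [m [w sw wp] mm] := class_min_size p; exists w => //.
split; first by exists w => //=; apply: Grefl.
by move=> _ [u uw <-]; rewrite sw; apply: mm; apply: Gtrans uw wp.
Qed.

Definition no_context_free_transversal := forall K : set (word X), K `<=` Geo G ->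
  (forall C, green_class G C -> exists2 w, K w & C (fim_pi w)) -> ~ context_free K.

Lemma no_context_free_Geo_SL : no_context_free_transversal ->
  no_context_free_transversal /\ ~ context_free (Geo G) /\
  (forall le : rel (letter X), total_order le -> ~ context_free (SL le G)).
Proof.
move=> main; split=> //; split=> [|le leo]; apply: main => //.
- exact: Geo_meets_classes.
- exact: SL_sub_Geo.
- by move=> C; apply: SL_meets_classes.
Qed.
End Representatives.

Lemma greenR_no_context_free_transversal (X : finType) :
  2 <= #|X| -> no_context_free_transversal (@greenR (FIM X)).
Proof.
move=> /card_gt1P [x [y [_ _ xy]]] K.
exact: (greenR_transversal_not_context_free xy).
Qed.

(** The words whose inverses lie in [K] are R-geodesics meeting every R-class. *)
Lemma greenL_no_context_free_transversal (X : finType) :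
  2 <= #|X| -> no_context_free_transversal (@greenL (FIM X)).
Proof.
move=> hX K KG KC /(context_free_mirror (@letter_invK X)).
apply: (greenR_no_context_free_transversal hX).
  by move=> w /= /KG /Geo_dual; rewrite -word_invE word_invK.
move=> C [p ->]; have [|w Kw wp] := KC [set c | greenL c (fim_pi (word_inv (repr p)))].
  by exists (fim_pi (word_inv (repr p))).
exists (word_inv w) => /=; first by rewrite -word_invE word_invK.
by move/green_dual: wp; rewrite word_invK fim_pi_repr.
Qed.

Theorem theorem8p1 (X : finType) (hX : 2 <= #|X|) :
  ((forall K : set (word X),
      K `<=` Geo (@greenL (FIM X)) ->
      (forall C : set (FIM X), green_class (@greenL (FIM X)) C ->
         exists2 w, K w & C (fim_pi w)) ->
      ~ context_free K)
   /\ ~ context_free (Geo (@greenL (FIM X)))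
   /\ (forall le : rel (letter X), total_order le ->
         ~ context_free (SL le (@greenL (FIM X)))))
  /\
  ((forall K : set (word X),
      K `<=` Geo (@greenR (FIM X)) ->
      (forall C : set (FIM X), green_class (@greenR (FIM X)) C ->
         exists2 w, K w & C (fim_pi w)) ->
      ~ context_free K)
   /\ ~ context_free (Geo (@greenR (FIM X)))
   /\ (forall le : rel (letter X), total_order le ->
         ~ context_free (SL le (@greenR (FIM X))))).
Proof.
split; apply: no_context_free_Geo_SL; rewrite /greenL /greenR //; try by move=> ? ? ? -> ->.
- exact: greenL_no_context_free_transversal.
- exact: greenR_no_context_free_transversal.
Qed.
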